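(* Let $q$ be a power of an odd prime, $n\ge 1$, and let $\omega$ be the Weil character of $\mathrm{Sp}(2n,q)$. Let $B=\{g_Q : Q\in\boldsymbol{S}_n\}$ and $G=\langle -I\rangle\times B\le \mathrm{Sp}(2n,q)$. Then $$\omega|_G=\frac{1+\delta^{n}}{2}\lambda_0^{+}+\frac{1-\delta^{n}}{2}\lambda_0^{-}+\sum_{\substack{S\in\boldsymbol{S}_n,\ \mathrm{rank}\,S=1\\ \Delta(S)=\delta}}(\lambda_S^{+}+\lambda_S^{-}).$$ In particular, $$\omega|_B=\lambda_0+2\sum_{\substack{S\in\boldsymbol{S}_n,\ \mathrm{rank}\,S=1\\ \Delta(S)=\delta}}\lambda_S .$$
   Context: $q$ is a power of an odd prime $p$, $V=GF(q)^{2n}$ consists of row vectors written as pairs $(x,y)$ with $x,y\in GF(q)^n$, and $\varphi((x_1,y_1),(x_2,y_2))=x_1y_2^T-y_1x_2^T$. $\mathrm{Sp}(2n,q)$ is the group of matrices preserving $\varphi$, acting on $V$ from the right. $\boldsymbol{S}_n$ is the space of symmetric $n\times n$ matrices over $GF(q)$. For $Q\in\boldsymbol{S}_n$, $g_Q=\begin{bmatrix} I&0\\ Q&I\end{bmatrix}\in\mathrm{Sp}(2n,q)$. $\psi(\alpha)=e^{(2\pi i/p)\mathrm{tr}(\alpha)}$ is the canonical additive character of $GF(q)$, with $\mathrm{tr}:GF(q)\to GF(p)$ the trace; $\chi$ is the quadratic character of $GF(q)^\times$; $\delta=\chi(-1)\in\{1,-1\}$. For $Q\in\boldsymbol{S}_n$,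 diagonalize $Q$ by congruence ($Q\mapsto M^TQM$, $M$ invertible) and let $\Delta(Q)=\chi(\text{product of the nonzero diagonal entries})$ (well defined), with $\Delta(0)=1$. For $S\in\boldsymbol{S}_n$, the linear character $\lambda_S$ of $B$ is $\lambda_S(g_Q)=\psi(\mathrm{Tr}(SQ))$ ($\mathrm{Tr}$ the matrix trace), and the linear characters $\lambda_S^{\pm}$ of $G$ are $\lambda_S^{\pm}(g_Q)=\psi(\mathrm{Tr}(SQ))$, $\lambda_S^{\pm}(-g_Q)=\pm\psi(\mathrm{Tr}(SQ))$. Weil character: up to equivalence there is a unique irreducible family of invertible operators $\pi(v)$, $v\in V$, on a complex space of dimension $q^n$ with $\pi(u)\pi(v)=\psi(\varphi(u,v))\pi(u+v)$ for all $u,v\in V$. The Weil representation is the complex linear representation $W$ of $\mathrm{Sp}(2n,q)$ on this space with $W(g)^{-1}\pi(v)W(g)=\pi(vg)$ for all $g\in \mathrm{Sp}(2n,q)$, $v\in V$, and $\omega$ is its character (of degree $q^n$). It is unique if $(n,q)\ne(1,3)$; for $(n,q)=(1,3)$ it is made unique by requiring in addition that each $W(g_Q)$ fix the vectors fixed by all $\pi(x,0)$, $x\in GF(q)^n$. *)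

(* Defs.v *)
From HB Require Import structures.
From mathcomp Require Import all_boot all_order all_algebra all_fingroup.
From mathcomp Require Import all_solvable all_field all_character sesquilinear.
From mathcomp Require Import complex.
From mathcomp Require Import reals trigo.

Set Implicit Arguments.
Unset Strict Implicit.
Unset Printing Implicit Defensive.

Import GroupScope.
Import GRing.Theory.
Local Open Scope ring_scope.
Local Open Scope complex_scope.

(* GF(q) is an arbitrary finite field F, with q = #|F|;
   complex numbers are R[i] for R : realType.  In everything that involves
   the symplectic group the half-dimension is n.+1, because {'GL_d[F]} consists
   of the matrices of size d.-1.+1. *)

Section AdditiveCharacter.

Variables (R : realType) (F : finFieldType) (p : nat) (pF : p \in [pchar F]).

(* The absolute trace; galTrace takes its values in the image of 'F_p in F,
   so the default value 0 is never used (abs_traceE). *)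
Definition abs_trace (a : F) : 'F_p :=
  let L : splittingFieldType 'F_p := pPrimeCharType pF in
  odflt 0 [pick k : 'F_p | k%:A == galTrace 1%AS {:L}%AS (a : L)].

Lemma abs_traceE (a : pPrimeCharType pF) :
  (abs_trace a)%:A = galTrace 1%AS {:pPrimeCharType pF}%AS a.
Proof.
rewrite /abs_trace; case: pickP => [k /eqP // | no_k].
have : galTrace 1%AS {:pPrimeCharType pF}%AS a \in 1%VS.
  have /galois_fixedField def1 :=
    finField_galois (sub1v {:pPrimeCharType pF}%AS).
  have := galTrace_fixedField 1%AS (memvf a : a \in {:pPrimeCharType pF}%AS).
  by rewrite def1.
by case/vlineP=> k def_k; have:= no_k k; rewrite def_k eqxx.
Qed.

Definition expi (theta : R) : R[i] := cos theta +i* sin theta.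

Definition psi (a : F) : R[i] := expi (2 * pi / p%:R * (abs_trace a)%:R).

End AdditiveCharacter.

Section Symmetric.

Variable F : finFieldType.

(* Only the values at nonzero arguments matter. *)
Definition quad_char (a : F) : int :=
  if a == 0 then 0 else if [exists b, a == b ^+ 2] then 1 else -1.

Definition delta : int := quad_char (-1).

(* Some diagonalization by congruence is chosen; the value does not depend on
   the choice.  A symmetric matrix always has one in odd characteristic, so the
   default value is irrelevant.  For Q = 0 the product is empty and the value
   is 1. *)
Definition Delta (n : nat) (Q : 'M[F]_n) : int :=
  if [pick M : 'M[F]_n | (M \in unitmx) && is_diag_mx (M^T *m Q *m M)] is Some M
  then let D := M^T *m Q *m M in quad_char (\prod_(i | D i i != 0) D i i)
  else 1.

Definition symp_form (n : nat) (u v : 'rV[F]_(n + n)) : F :=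
  (lsubmx u *m (rsubmx v)^T - rsubmx u *m (lsubmx v)^T) 0 0.

End Symmetric.

Lemma symmetricmxE (F : finFieldType) (n : nat) (Q : 'M[F]_n) :
  (Q \is symmetricmx) = (Q^T == Q).
Proof. by rewrite qualifE /= expr0 scale1r map_mx_id // eq_sym. Qed.

Section SymplecticGroup.

Variables (F : finFieldType) (n : nat).

Local Notation GL2 := {'GL_(n.+1 + n.+1)[F]}.

(* The dimension (n.+1 + n.+1).-1.+1 of GLval g reduces to n.+1 + n.+1. *)
Definition GLmx (g : GL2) : 'M[F]_(n.+1 + n.+1) := GLval g.

Lemma GLmx_inj : injective GLmx.
Proof. exact: val_inj. Qed.

Lemma GLmx1 : GLmx 1%g = 1%:M.
Proof. by []. Qed.

Lemma GLmxM (g h : GL2) : GLmx (g * h)%g = GLmx g *m GLmx h.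
Proof. by []. Qed.

Definition Sp_set : {set GL2} :=
  [set g | [forall u, forall v,
     symp_form (u *m GLmx g) (v *m GLmx g) == symp_form u v]].

Lemma SpP (g : GL2) :
  reflect (forall u v, symp_form (u *m GLmx g) (v *m GLmx g) = symp_form u v)
          (g \in Sp_set).
Proof.
rewrite inE; apply: (iffP 'forall_forallP) => H u v; first by apply/eqP.
by rewrite H.
Qed.

Lemma Sp_group_set : group_set Sp_set.
Proof.
apply/group_setP; split; first by apply/SpP=> u v; rewrite GLmx1 !mulmx1.
move=> g h /SpP Hg /SpP Hh; apply/SpP=> u v.
by rewrite GLmxM !mulmxA Hh Hg.
Qed.
Canonical Sp : {group GL2} := Group Sp_group_set.

Definition gQ_mx (Q : 'M[F]_n.+1) : 'M[F]_(n.+1 + n.+1) :=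
  block_mx 1%:M 0 Q 1%:M.

Lemma gQ_unit (Q : 'M[F]_n.+1) :
  (gQ_mx Q : 'M[F]_((n.+1 + n.+1).-1.+1)) \is a GRing.unit.
Proof.
have: gQ_mx Q \in unitmx by rewrite unitmxE det_lblock !det1 mulr1 unitr1.
by [].
Qed.

Definition gQ (Q : 'M[F]_n.+1) : GL2 := FinRing.unit _ (gQ_unit Q).

Definition GLN1 : GL2 :=
  FinRing.unit _ (unitrN1 'M[F]_((n.+1 + n.+1).-1.+1)).

Lemma GLmx_gQ (Q : 'M[F]_n.+1) : GLmx (gQ Q) = block_mx 1%:M 0 Q 1%:M.
Proof. by []. Qed.

Lemma GLmxN1 : GLmx GLN1 = - 1%:M.
Proof. by []. Qed.

Lemma gQ_inj : injective gQ.
Proof.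
by move=> P Q /(congr1 GLmx); rewrite !GLmx_gQ => /eq_block_mx[].
Qed.

Lemma gQM (P Q : 'M[F]_n.+1) : (gQ P * gQ Q)%g = gQ (P + Q).
Proof.
apply: GLmx_inj; rewrite GLmxM !GLmx_gQ mulmx_block.
by rewrite !(mul1mx, mulmx1, mul0mx, mulmx0, addr0, add0r).
Qed.

Lemma gQ0 : gQ 0 = 1%g.
Proof. by apply: GLmx_inj; rewrite GLmx_gQ GLmx1 -scalar_mx_block. Qed.

Definition B_set : {set GL2} :=
  [set gQ Q | Q in [pred Q : 'M[F]_n.+1 | Q \is symmetricmx]].

Lemma B_group_set : group_set B_set.
Proof.
apply/group_setP; split.
  by apply/imsetP; exists 0; rewrite ?gQ0 // inE symmetricmxE trmx0.
move=> _ _ /imsetP[P sP ->] /imsetP[Q sQ ->]; rewrite gQM.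
apply: imset_f; move: sP sQ; rewrite !inE !symmetricmxE linearD /=.
by move=> /eqP-> /eqP->.
Qed.
Canonical B : {group GL2} := Group B_group_set.

Definition G : {group GL2} := (<[GLN1]> <*> B)%G.

End SymplecticGroup.

Lemma GLN1_notin_B (F : finFieldType) (n p : nat) (pF : p \in [pchar F]) :
  odd p -> GLN1 F n \notin B F n.
Proof.
move=> p_odd; apply/imsetP=> -[Q _ /(congr1 (@GLmx F n))].
rewrite GLmxN1 GLmx_gQ => /(congr1 ulsubmx).
rewrite block_mxKul => /matrixP/(_ 0 0); rewrite !mxE !eqxx /= => /eqP.
rewrite eq_sym -addr_eq0 -mulr2n -(dvdn_pcharf pF) => p2.
have p_pr := pcharf_prime pF.
by move: p_odd; rewrite (eqP (_ : p == 2%N)) // -(dvdn_prime2 p_pr).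
Qed.

Lemma GLN1_sqr (F : finFieldType) (n : nat) :
  (GLN1 F n * GLN1 F n)%g = 1%g.
Proof.
by apply: GLmx_inj; rewrite GLmxM GLmxN1 mulNmx mulmxN opprK mul1mx.
Qed.

Lemma G_dprod (F : finFieldType) (n p : nat) (pF : p \in [pchar F]) :
  odd p -> <[GLN1 F n]> \x B F n = G F n.
Proof.
move=> p_odd; apply: dprodEY.
  rewrite cent_cycle; apply/subsetP=> g _; apply/cent1P.
  by apply: GLmx_inj; rewrite !GLmxM GLmxN1 mulNmx mulmxN mul1mx mulmx1.
apply/trivgP/subsetP=> g /setIP[/cycleP[i ->]].
rewrite -(odd_double_half i) expgD -mul2n expgM !expgS expg0 mulg1 GLN1_sqr.
rewrite expg1n mulg1; case: (odd i); last by rewrite expg0 inE.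
by rewrite expg1 (negPf (GLN1_notin_B n pF p_odd)).
Qed.

Lemma G_sub_Sp (F : finFieldType) (n : nat) : G F n \subset Sp F n.
Proof.
rewrite join_subG cycle_subG; apply/andP; split.
  apply/SpP=> u v; rewrite GLmxN1 !mulmxN !mulmx1 /symp_form.
  by rewrite !linearN /= !mulNmx !opprK.
apply/subsetP=> _ /imsetP[Q + ->]; rewrite inE symmetricmxE => /eqP sQ.
apply/SpP=> u v; rewrite GLmx_gQ -(hsubmxK u) -(hsubmxK v) /symp_form.
rewrite !mul_row_block !(row_mxKl, row_mxKr) !mulmx1 !mulmx0 !add0r.
rewrite linearD /= trmx_mul sQ mulmxDl mulmxDr mulmxA; congr (_ _ _).
by rewrite opprD addrACA subrr addr0.
Qed.

Section LinearCharacters.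

Variables (R : realType) (F : finFieldType) (p : nat) (pF : p \in [pchar F]).
Variable n : nat.

Local Notation GL2 := {'GL_(n.+1 + n.+1)[F]}.

(* Meant for g in B: Q is the lower left block of g_Q. *)
Definition lambda (S : 'M[F]_n.+1) (g : GL2) : R[i] :=
  psi R pF (\tr (S *m dlsubmx (GLmx g))).

(* lambda_S^+ for eps = false, lambda_S^- for eps = true, meant for g in G;
   see lambdaG_gQ and lambdaG_NgQ. *)
Definition lambdaG (eps : bool) (S : 'M[F]_n.+1) (g : GL2) : R[i] :=
  if g \in B F n then lambda S g else (-1) ^+ eps * lambda S (GLN1 F n * g)%g.

Lemma lambda_gQ (S Q : 'M[F]_n.+1) : lambda S (gQ Q) = psi R pF (\tr (S *m Q)).
Proof. by rewrite /lambda GLmx_gQ block_mxKdl. Qed.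

Lemma lambdaG_gQ (eps : bool) (S Q : 'M[F]_n.+1) :
  Q \is symmetricmx -> lambdaG eps S (gQ Q) = psi R pF (\tr (S *m Q)).
Proof. by move=> sQ; rewrite /lambdaG imset_f ?inE // lambda_gQ. Qed.

Lemma lambdaG_NgQ (eps : bool) (S Q : 'M[F]_n.+1) :
  odd p -> Q \is symmetricmx ->
  lambdaG eps S (GLN1 F n * gQ Q)%g = (-1) ^+ eps * psi R pF (\tr (S *m Q)).
Proof.
move=> p_odd sQ; have BQ : gQ Q \in B F n by rewrite imset_f ?inE.
rewrite /lambdaG groupMr // (negPf (GLN1_notin_B n pF p_odd)).
by rewrite mulgA GLN1_sqr mul1g lambda_gQ.
Qed.

End LinearCharacters.

Section WeilRepresentation.

Variables (R : realType) (F : finFieldType) (p : nat) (pF : p \in [pchar F]).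
Variable n : nat.

(* Operators on a complex space of dimension q ^ n.+1 are given by their
   matrices, acting on column vectors. *)
Local Notation V := 'rV[F]_(n.+1 + n.+1).
Local Notation dimW := (#|F| ^ n.+1)%N.

Definition irreducible_family (pi : V -> 'M[R[i]]_dimW) : Prop :=
  forall U : {vspace 'cV[R[i]]_dimW},
    (forall v f, f \in U -> pi v *m f \in U) -> U = 0%VS \/ U = fullv.

Definition heisenberg_family (pi : V -> 'M[R[i]]_dimW) : Prop :=
  [/\ forall v, pi v \in unitmx,
      forall u v, pi u *m pi v = psi R pF (symp_form u v) *: pi (u + v)
    & irreducible_family pi].

Definition weil_representation
    (W : mx_representation R[i] (Sp F n) dimW) : Prop :=
  exists pi : V -> 'M[R[i]]_dimW,
    [/\ heisenberg_family pi,
        forall g, g \in Sp F n -> forall v,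
          invmx (W g) *m pi v *m W g = pi (v *m GLmx g)
      & n.+1 = 1%N -> #|F| = 3%N ->
        forall Q : 'M[F]_n.+1, Q \is symmetricmx ->
        forall f : 'cV[R[i]]_dimW,
          (forall x : 'rV[F]_n.+1, pi (row_mx x 0) *m f = f) ->
          W (gQ Q) *m f = f].

Definition weil_character (omega : {'GL_(n.+1 + n.+1)[F]} -> R[i]) : Prop :=
  exists2 W : mx_representation R[i] (Sp F n) dimW,
    weil_representation W & forall g, g \in Sp F n -> omega g = \tr (W g).

End WeilRepresentation.

(* Main.v *)
(* The operators pi (x, 0) commute and their common fixed space is a line, the
   range of a rank-one projection P; its translates by the pi (0, y) give a
   basis e_y of the whole space.  W(g_Q) commutes with all pi (x, 0), hence is
   diagonal: W(g_Q) e_y = c(Q) psi(- y Q y^T) e_y for a linear character c of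
   the symmetric matrices.  The Levi elements diag(M, M^-T) preserve the line
   of P, so c is invariant under congruence, and therefore trivial.  Since -I
   maps e_y to kappa e_(-y), tr W(g_Q) = \sum_y psi(Tr(- y^T y Q)) and
   tr W(- g_Q) = kappa.  The map y |-> - y^T y is two-to-one from the nonzero
   rows onto the symmetric S of rank one with Delta(S) = delta.  Finally, for
   the Weyl element w, the relations w^2 = -I and (w g_I)^3 = -I express kappa
   through the quadratic Gauss sum, and kappa = delta^n. *)
Require Import Defs.
From HB Require Import structures.
From mathcomp Require Import all_boot all_order all_algebra all_fingroup.
From mathcomp Require Import all_solvable all_field all_character sesquilinear.
From mathcomp Require Import complex.
From mathcomp Require Import reals trigo ring.

Set Implicit Arguments.
Unset Strict Implicit.
Unset Printing Implicit Defensive.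

Import GroupScope.
Import GRing.Theory Num.Theory Order.TTheory.
Local Open Scope ring_scope.

(** * The exponential on the imaginary axis *)

Section Expi.

Variable R : realType.

Lemma expi0 : expi 0 = 1 :> R[i].
Proof. by rewrite /expi cos0 sin0. Qed.

Lemma expiD (a b : R) : expi (a + b) = expi a * expi b.
Proof.
apply/eqP; rewrite eq_complex /= cosD sinD eqxx addrC (mulrC (sin a)) addrC.
by rewrite eqxx.
Qed.

Lemma expi_natmul (a : R) k : expi (a * k%:R) = expi a ^+ k.
Proof.
elim: k => [|k IHk]; first by rewrite mulr0 expi0.
by rewrite -addn1 natrD mulrDr mulr1 expiD IHk exprD.
Qed.

Lemma expi2pi : expi (2 * pi : R) = 1.
Proof. by rewrite /expi mulr_natl cos2pi sin2pi. Qed.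

End Expi.

(** * The absolute trace *)

Section AbsTrace.

Variables (F : finFieldType) (p : nat) (pF : p \in [pchar F]).

Local Notation L := (pPrimeCharType pF).
Local Notation tr := (abs_trace pF).

Lemma abs_traceD a b : tr (a + b) = tr a + tr b.
Proof.
apply: (fmorph_inj (in_alg L)) => /=.
by rewrite scalerDl !abs_traceE raddfD.
Qed.

Lemma abs_traceZ (k : 'F_p) a : tr (k%:R * a) = k * tr a.
Proof.
apply: (fmorph_inj (in_alg L)) => /=.
rewrite abs_traceE -scalerA abs_traceE /galTrace scaler_sumr.
apply: eq_bigr => x _; rewrite -linearZ /=; congr (x _).
Qed.

(** Linear independence of the Galois automorphisms gives a nonzero trace, which linearity over the
    prime field rescales to 1. *)
Lemma abs_trace_eq1 : exists a, tr a = 1.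
Proof.
have nz1 : (1 : L) != 0 by exact: oner_neq0.
have [a _ nz] := @gal_independent_contra _ L {:L}%AS
  [in 'Gal({:L}%AS / 1%AS)] (fun=> 1) 1%g (group1 _) nz1.
have {nz} nz : tr a != 0.
  apply: contraNneq nz => tr0; apply/eqP; move: (abs_traceE (a : L)).
  rewrite tr0 scale0r => /esym E; rewrite -[RHS]E.
  by apply: eq_bigr => x _; rewrite mul1r.
by exists ((tr a)^-1%:R * a); rewrite abs_traceZ mulVf.
Qed.

End AbsTrace.

Lemma sum_fibers (T A : finType) (C : nzRingType) (f : T -> A) (g : A -> C) :
  \sum_t g (f t) = \sum_a #|[set t | f t == a]|%:R * g a.
Proof.
rewrite (partition_big f xpredT) //=; apply: eq_bigr => a _.
rewrite (eq_bigr (fun=> g a)) => [|t /eqP-> //].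
rewrite sumr_const mulr_natl; congr (_ *+ _).
by apply: eq_card => t; rewrite !inE.
Qed.

(** * Squares and nonsquares in a finite field *)

Section Squares.

Variable F : finFieldType.

Lemma quad_charM_sqr (a b : F) : b != 0 -> quad_char (a * b ^+ 2) = quad_char a.
Proof.
move=> b0; rewrite /quad_char mulf_eq0 expf_eq0 (negPf b0) andbF orbF.
case: eqP => // _; congr (if _ then _ else _); apply/existsP/existsP.
  case=> c /eqP E; exists (c / b); rewrite expr_div_n -E mulfK //.
  by rewrite expf_eq0 (negPf b0) andbF.
by case=> c /eqP ->; exists (c * b); rewrite exprMn.
Qed.

(** The unit group is cyclic; nonsquares are odd powers of a generator, so the product of two of
    them is an even power. *)
Lemma nonsquare_mul (a b : F) :
  ~~ [exists c, a == c ^+ 2] -> ~~ [exists c, b == c ^+ 2] ->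
  exists c, a * b = c ^+ 2.
Proof.
have odd_log (x : {unit F}) g i : x = (g ^+ i)%g ->
    ~~ [exists c, FinRing.uval x == c ^+ 2] -> odd i.
  move=> ->; apply: contraNT => /even_halfK <-; apply/existsP.
  by exists (FinRing.uval (g ^+ i./2)%g); rewrite -muln2 expgM expr2.
have nz x : ~~ [exists c, x == c ^+ 2] -> x != 0.
  by apply: contraNneq => ->; apply/existsP; exists 0; rewrite expr0n.
move=> na nb; have ua : a \is a GRing.unit by rewrite unitfE nz.
have ub : b \is a GRing.unit by rewrite unitfE nz.
have /cyclicP[g /setP gen] := field_unit_group_cyclic [set: {unit F}].
have /cycleP[i Ei] : FinRing.unit F ua \in <[g]>%g by rewrite -gen inE.
have /cycleP[j Ej] : FinRing.unit F ub \in <[g]>%g by rewrite -gen inE.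
have oi := odd_log _ _ _ Ei na; have oj := odd_log _ _ _ Ej nb.
exists (FinRing.uval (g ^+ (i + j)./2)%g).
have -> : a * b = FinRing.uval (FinRing.unit F ua * FinRing.unit F ub)%g by [].
rewrite Ei Ej -expgD -[in LHS](@even_halfK (i + j)) ?oddD ?oi ?oj //.
by rewrite -muln2 expgM expr2.
Qed.

Lemma delta_sqrN1 : delta F = if [exists b : F, -1 == b ^+ 2] then 1 else -1.
Proof. by rewrite /delta /quad_char oppr_eq0 oner_eq0. Qed.

Lemma delta_sqr : delta F * delta F = 1.
Proof. by rewrite delta_sqrN1; case: ifP. Qed.

End Squares.

(** * The additive character and its quadratic Gauss sum *)

Section Psi.

Variables (R : realType) (F : finFieldType) (p : nat) (pF : p \in [pchar F]).
Hypothesis p_odd : odd p.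

Local Notation psi := (psi R pF).

Let p_pr : prime p := pcharf_prime pF.
Let p_gt2 : (2 < p)%N.
Proof. by rewrite odd_prime_gt2. Qed.

Lemma two_neq0 : (2 : F) != 0.
Proof. by rewrite -(dvdn_pcharf pF) gtnNdvd. Qed.

Let zeta : R[i] := expi (2 * pi / p%:R).

Let psiE a : psi a = zeta ^+ abs_trace pF a.
Proof. exact: expi_natmul. Qed.

Let zetap : zeta ^+ p = 1.
Proof.
by rewrite -expi_natmul divfK ?expi2pi // pnatr_eq0 -lt0n prime_gt0.
Qed.

Lemma psi0 : psi 0 = 1.
Proof.
suff E: abs_trace pF 0 = 0 by rewrite psiE E.
by apply: (@addrI _ (abs_trace pF 0)); rewrite -abs_traceD !addr0.
Qed.

Lemma psiD a b : psi (a + b) = psi a * psi b.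
Proof.
rewrite !psiE -exprD abs_traceD /=.
move: (nat_of_ord _) (nat_of_ord (abs_trace pF b)) => i j.
by rewrite Fp_cast // [in RHS](divn_eq (i + j) p) exprD mulnC exprM zetap
  expr1n mul1r.
Qed.

Lemma psiK a : psi a * psi (- a) = 1.
Proof. by rewrite -psiD subrr psi0. Qed.

(** At an element of trace 1 the value is [zeta], whose imaginary part is positive because
    [p > 2]. *)
Lemma psi_nontrivial : exists a, psi a != 1.
Proof.
have [a tra] := abs_trace_eq1 pF; exists a; rewrite psiE tra.
have -> : (1 : 'F_p) = 1%N :> nat by rewrite /= modn_small.
have p0 : 0 < p%:R :> R by rewrite ltr0n prime_gt0.
have : 0 < sin (2 * pi / p%:R : R).
  apply: sin_gt0_pi; rewrite divr_gt0 ?mulr_gt0 ?pi_gt0 //=.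
  by rewrite mulrAC gtr_pMl ?pi_gt0 // ltr_pdivrMr // mul1r ltr_nat.
apply: contraTneq; rewrite expr1 /zeta /expi => -[_ ->].
by rewrite ltxx.
Qed.

(** Translation by [v] fixes the sum and also multiplies it by [psi (f v)]. *)
Lemma psi_sum (V : finZmodType) (f : V -> F) (v : V) :
  {morph f : u w / u + w} -> psi (f v) != 1 -> \sum_u psi (f u) = 0.
Proof.
move=> fD nz; set s := (X in X = 0).
have E : psi (f v) * s = s.
  rewrite {2}/s (reindex_inj (addrI v)) mulr_sumr.
  by apply: eq_bigr => u _; rewrite fD psiD.
apply/eqP; move/eqP: E; rewrite -subr_eq0 -{2}[s]mul1r -mulrBl mulf_eq0.
by rewrite subr_eq0 (negPf nz).
Qed.

Lemma psi_sum_scale a : \sum_t psi (t * a) = if a == 0 then #|F|%:R else 0.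
Proof.
case: eqVneq => [->|a0].
  under eq_bigr do rewrite mulr0 psi0.
  by rewrite sumr_const.
have [b nb] := psi_nontrivial.
apply: (@psi_sum F (fun t => t * a) (b / a)); last by rewrite divfK.
by move=> t u; rewrite mulrDl.
Qed.

(** The complex conjugate of the usual quadratic Gauss sum; the sign matches the eigenvalues
    [psi (- dot z z)] of [g_I]. *)
Definition gauss_sum : R[i] := \sum_t psi (- t ^+ 2).

(** Replacing the second variable by [t + u] makes the exponent linear in [t], so the sum over [t]
    kills every term with [u] nonzero. *)
Lemma gauss_sum_norm : gauss_sum * (\sum_t psi (t ^+ 2)) = #|F|%:R.
Proof.
rewrite /gauss_sum mulr_suml.
under eq_bigr => t _.
  rewrite mulr_sumr (reindex_inj (addrI t)) /=.
  under eq_bigr => u _.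
    rewrite -psiD (_ : _ + _ = t * (2 * u) + u ^+ 2); last by ring.
    rewrite psiD; over.
  over.
rewrite exchange_big (bigD1 0) //= [X in _ + X]big1 => [|u u0].
  by rewrite addr0 -mulr_suml psi_sum_scale mulr0 eqxx expr0n psi0 mulr1.
by rewrite -mulr_suml psi_sum_scale mulf_eq0 (negPf two_neq0) (negPf u0) mul0r.
Qed.

(* If -1 is not a square, the squares and their opposites together cover each
   element of F exactly twice. *)
Lemma gauss_sum_conj : \sum_t psi (t ^+ 2) = (delta F)%:~R * gauss_sum.
Proof.
rewrite delta_sqrN1; case: ifPn => [/existsP[b /eqP Eb]|nsq].
  have b0 : b != 0.
    by apply: contra_eq_neq Eb => ->; rewrite expr0n /= oppr_eq0 oner_eq0.
  rewrite mul1r /gauss_sum (reindex_inj (mulIf b0)) /=.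
  by apply: eq_bigr => t _; rewrite exprMn -Eb mulrN1.
suff: \sum_t psi (t ^+ 2) + gauss_sum = 2 * \sum_a psi (a * 1).
  rewrite psi_sum_scale oner_eq0 mulr0 mulN1r => /eqP.
  by rewrite addr_eq0 => /eqP.
rewrite /gauss_sum (sum_fibers (fun t => t ^+ 2)).
rewrite (sum_fibers (fun t => - t ^+ 2)).
rewrite -big_split mulr_sumr /=.
apply: eq_bigr => a _; rewrite mulr1 -mulrDl -natrD; congr (_%:R * _).
have cardsq c : c != 0 -> #|[set t : F | t ^+ 2 == c ^+ 2]| = 2%N.
  move=> c0; rewrite (_ : [set t | _] = [set c; - c]).
    rewrite cards2 -addr_eq0 -mulr2n -mulr_natl.
    by rewrite mulf_eq0 (negPf two_neq0) (negPf c0).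
  by apply/setP => t; rewrite !inE eqf_sqr.
have card0 (f : F -> F) : (forall t, f t != a) -> #|[set t | f t == a]| = 0%N.
  move=> H; apply/eqP; rewrite cards_eq0; apply/eqP/setP=> t.
  by rewrite !inE (negPf (H t)).
have [->|a0] := eqVneq a 0.
  rewrite (_ : [set t | _] = [set 0]); last first.
    by apply/setP=> t; rewrite !inE sqrf_eq0.
  rewrite (_ : [set t | _] = [set 0]) ?cards1 //.
  by apply/setP=> t; rewrite !inE oppr_eq0 sqrf_eq0.
have [/existsP[c /eqP Ea]|na] := boolP [exists c, a == c ^+ 2].
  have c0 : c != 0 by apply: contraNneq a0 => c0; rewrite Ea c0 expr0n.
  (* If also [a = - t ^+ 2], then [c / t] would be a square root of [-1]. *)
  rewrite Ea cardsq // -Ea card0 // => t.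
  apply: contraNneq nsq => Et; apply/existsP; exists (c / t).
  have t0 : t != 0 by apply: contraNneq a0 => t0; rewrite -Et t0 expr0n oppr0.
  by rewrite expr_div_n -Ea -Et mulNr divff // sqrf_eq0.
have [c Ec] := nonsquare_mul nsq na; rewrite mulN1r in Ec.
have c0 : c != 0 by apply: contraNneq a0 => c0; rewrite -oppr_eq0 Ec c0 expr0n.
rewrite card0 ?add0n => [|t]; last first.
  by apply: contraNneq na => <-; apply/existsP; exists t.
apply: etrans (cardsq _ c0); apply: eq_card => t; rewrite !inE -Ec /=.
by apply/eqP/eqP => [<-|->]; rewrite opprK.
Qed.

Lemma gauss_sum_sqr : gauss_sum ^+ 2 = (delta F)%:~R * #|F|%:R.
Proof.
rewrite -gauss_sum_norm gauss_sum_conj mulrCA [_%:~R * (_ * _)]mulrA.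
by rewrite -intrM delta_sqr mul1r expr2.
Qed.

End Psi.

(** * Symmetric matrices of rank one *)

Section RankOne.

Variable F : finFieldType.

Lemma outerE (n : nat) (w : 'rV[F]_n) i j : (w^T *m w) i j = w 0 i * w 0 j.
Proof. by rewrite mxE big_ord1 mxE. Qed.

(** Congruence by [M] replaces [r] by [w = r *m M]. If the result is diagonal, [w] has a single
    nonzero entry, so the product is [a] times a nonzero square. *)
Lemma Delta_outer (n : nat) (a : F) (r : 'rV[F]_n) :
  a != 0 -> r != 0 -> Delta (a *: (r^T *m r)) = quad_char a.
Proof.
have congrE M : M^T *m (a *: (r^T *m r)) *m M = a *: ((r *m M)^T *m (r *m M)).
  by rewrite trmx_mul -!scalemxAr -!scalemxAl !mulmxA.
move=> a0 r0; rewrite /Delta; case: pickP => [M /andP[uM]|noM].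
  rewrite congrE; set w := r *m M => /is_diag_mxP Dw.
  have : w != 0.
    by apply: contraNneq r0 => w0; rewrite -(mulmxK uM r) -/w w0 mul0mx.
  case/rV0Pn => i wi0.
  have wj0 j : j != i -> w 0 j = 0.
    move=> ji; have /eqP := Dw j i ji; rewrite mxE outerE !mulf_eq0 (negPf a0).
    by rewrite (negPf wi0) orbF => /eqP.
  have wi j : ((a *: (w^T *m w)) j j != 0) = (j == i).
    rewrite mxE outerE !mulf_eq0 (negPf a0) orbb /=.
    by have [->//|/wj0->] := eqVneq j i; rewrite eqxx.
  rewrite (big_pred1 i) => [|j]; last exact: wi.
  by rewrite mxE outerE -expr2 quad_charM_sqr.
(* The default value of [Delta] is excluded: the inverse of [row_ebase r] moves [r] to a row
   supported on coordinate 0, which makes the form diagonal. *)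
have uE := row_ebase_unit r.
have := noM (invmx (row_ebase r)); rewrite unitmx_inv uE congrE.
have -> : r *m invmx (row_ebase r) = col_ebase r *m pid_mx (\rank r).
  by rewrite -{1}(mulmx_ebase r) mulmxK.
case/is_diag_mxP => i j ij; rewrite mxE outerE !mxE !big_ord1 !mxE.
case: (eqVneq (0%N) (i : nat)) => i0 /=; last by rewrite mulr0 mul0r mulr0.
case: (eqVneq (0%N) (j : nat)) => j0 /=; last by rewrite !mulr0.
by rewrite -i0 -j0 eqxx in ij.
Qed.

(** A diagonal entry determines one nonzero coordinate up to sign; its products with the other
    coordinates determine the rest. *)
Lemma outer_eq (n : nat) (z w : 'rV[F]_n) :
  (z^T *m z == w^T *m w) = (z == w) || (z == - w).
Proof.
apply/eqP/orP=> [E|[]/eqP->//]; last by rewrite mulmxN linearN /= mulNmx opprK.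
have {}E i j : z 0 i * z 0 j = w 0 i * w 0 j by rewrite -!outerE E.
have [z0|/rV0Pn[i zi]] := eqVneq z 0.
  left; rewrite z0 eq_sym; apply: contraT => /rV0Pn[i wi].
  have := E i i; rewrite z0 mxE mul0r => /esym/eqP.
  by rewrite mulf_eq0 (negPf wi).
have /eqP := E i i; rewrite -!expr2 eqf_sqr => /orP[]/eqP ziE; [left|right].
  by apply/eqP/rowP=> j; apply: (mulfI zi); rewrite E ziE.
by apply/eqP/rowP=> j; apply: (mulfI zi); rewrite E ziE mxE mulrNN.
Qed.

Hypothesis two_neq0 : (2 : F) != 0.

Lemma row_neq_opp (n : nat) (z : 'rV[F]_n) : (z == - z) = (z == 0).
Proof.
rewrite -addr_eq0; apply/eqP/eqP => [|->]; last by rewrite addr0.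
move/rowP=> E; apply/rowP=> i; have := E i; rewrite !mxE -mulr2n -mulr_natl.
by move/eqP; rewrite mulf_eq0 (negPf two_neq0) => /eqP.
Qed.

(** A rank factorization and symmetry give [S = a *: (r^T *m r)]. The condition on [Delta] says that
    [a] and [-1] have the same quadratic character, so [- a] is a square [b ^+ 2] and [z = b *: r]
    works. *)
Lemma rank1_symmetricP (n : nat) (S : 'M[F]_n) :
  reflect (exists2 z : 'rV[F]_n, z != 0 & S = - (z^T *m z))
    [&& S \is symmetricmx, \rank S == 1%N & Delta S == delta F].
Proof.
have outerN (z : 'rV[F]_n) : - (z^T *m z) = -1 *: (z^T *m z).
  by rewrite scaleN1r.
apply: (iffP and3P) => [[symS rk1 DS]|[z z0 ->]]; last first.
  rewrite symmetricmxE linearN /= trmx_mul trmxK; split=> //.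
    rewrite eqn_leq mxrank_opp (leq_trans (mxrankM_maxr _ _)) ?rank_leq_row //.
    rewrite lt0n mxrank_eq0; case/rV0Pn: z0 => i zi.
    apply/eqP=> /matrixP/(_ i i); rewrite outerE mxE => /eqP.
    by rewrite mulf_eq0 (negPf zi).
  by rewrite outerN Delta_outer // oppr_eq0 oner_eq0.
have [c [r ES]] : exists c : 'cV_n, exists r : 'rV_n, S = c *m r.
  exists (castmx (erefl, eqP rk1) (col_base S)).
  exists (castmx (eqP rk1, erefl) (row_base S)).
  by rewrite -{1}(mulmx_base S); case: _ / (eqP rk1).
have {}ES i j : S i j = c i 0 * r 0 j by rewrite ES mxE big_ord1.
have S0 : S != 0 by rewrite -mxrank_eq0 (eqP rk1).
have r0 : r != 0.
  apply: contraNneq S0 => r0; apply/eqP/matrixP=> i j.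
  by rewrite ES r0 !mxE mulr0.
have /rV0Pn[j rj] := r0.
pose a := c j 0 / r 0 j.
have {}ES : S = a *: (r^T *m r).
  apply/matrixP=> i k; rewrite mxE outerE ES /a mulrA; congr (_ * _).
  apply: (mulIf rj); rewrite -ES mulrAC divfK // -ES.
  by move: symS; rewrite symmetricmxE => /eqP {1}<-; rewrite mxE.
have a0 : a != 0 by apply: contraNneq S0 => a0; rewrite ES a0 scale0r.
move: DS; rewrite ES Delta_outer // => qa.
suff [b Eb] : exists b, - a = b ^+ 2.
  have b0 : b != 0.
    by apply: contra_eq_neq Eb => ->; rewrite expr0n /= oppr_eq0.
  exists (b *: r); first by rewrite scaler_eq0 negb_or b0.
  rewrite -scalemxAr [(b *: r)^T]linearZ /= -scalemxAl scalerA -expr2 -Eb.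
  by rewrite scaleNr opprK.
move: qa; rewrite delta_sqrN1 /quad_char (negPf a0).
case: ifPn => [/existsP[c1 /eqP E1]|n1];
  case: ifPn => [/existsP[c2 /eqP E2]|n2] // _.
  by exists (c1 * c2); rewrite -mulN1r E2 E1 exprMn mulrC.
by rewrite -mulN1r; exact: nonsquare_mul.
Qed.

(* z |-> - z^T z is two-to-one from the nonzero rows onto the index set. *)
Lemma sum_rank1 (n : nat) (C : nzRingType) (f : 'M[F]_n -> C) :
  \sum_(z : 'rV[F]_n) f (- (z^T *m z)) =
    f 0 + 2 * \sum_(S : 'M[F]_n |
      [&& S \is symmetricmx, \rank S == 1%N & Delta S == delta F]) f S.
Proof.
rewrite (bigD1 0) //= mulmx0 oppr0; congr (_ + _).
rewrite (partition_big (fun z : 'rV[F]_n => - (z^T *m z))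
  (fun S => [&& S \is symmetricmx, \rank S == 1%N & Delta S == delta F])) /=.
  rewrite mulr_sumr; apply: eq_bigr => _ /rank1_symmetricP[w w0 ->].
  rewrite (eq_bigr (fun=> f (- (w^T *m w)))) => [|z /andP[_ /eqP->] //].
  rewrite sumr_const mulr_natl; congr (_ *+ _).
  transitivity #|[set w; - w]|; last by rewrite cards2 row_neq_opp w0.
  apply: eq_card => z; rewrite !inE [LHS]unfold_in /= eqr_opp outer_eq.
  have [->|//] := eqVneq z 0.
  by rewrite eq_sym (negPf w0) eq_sym oppr_eq0 (negPf w0).
by move=> z z0; apply/rank1_symmetricP; exists z.
Qed.

End RankOne.

(** A rank factorization [P = C *m D] of an idempotent has [D *m C = 1%:M], so the trace of [P] is
    its rank. Hence the rank is 1, and [D *m X *m C] is a scalar. *)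
Lemma idem_trace1 (K : numFieldType) N (P X : 'M[K]_N) :
  P *m P = P -> \tr P = 1 -> P *m X *m P = \tr (X *m P) *: P.
Proof.
move=> idP trP.
have [r [C [D [defP CD1]]]] : exists r, exists C : 'M[K]_(N, r),
    exists D : 'M[K]_(r, N), P = C *m D /\ D *m C = 1%:M.
  exists (\rank P), (col_base P), (row_base P).
  split; first by rewrite mulmx_base.
  apply: (row_full_inj (col_base_full P)).
  apply: (row_free_inj (row_base_free P)).
  by rewrite mulmx1 [X in X *m _]mulmxA mulmx_base -[LHS]mulmxA mulmx_base.
have r1 : r = 1%N.
  have := trP; rewrite defP mxtrace_mulC CD1 mxtrace1 => /eqP.
  by rewrite -[1]/(1%:R) eqr_nat => /eqP.
subst r; rewrite defP.
have -> : C *m D *m X *m (C *m D) = C *m (D *m X *m C) *m D by rewrite !mulmxA.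
rewrite [D *m X *m C]mx11_scalar mul_mx_scalar -scalemxAl; congr (_ *: _).
rewrite mulmxA mxtrace_mulC mulmxA [in RHS](mx11_scalar (_ *m C)).
by rewrite mxtrace_scalar.
Qed.

(** * The dot product and character sums over rows *)

Section Dot.

Variables (F : finFieldType) (n : nat).
Implicit Types x y : 'rV[F]_n.

Definition dot x y : F := (x *m y^T) 0 0.

Lemma dotE x y : dot x y = \sum_i x 0 i * y 0 i.
Proof. by rewrite /dot mxE; apply: eq_bigr => i _; rewrite mxE. Qed.

Lemma dotC x y : dot x y = dot y x.
Proof. by rewrite !dotE; apply: eq_bigr => i _; rewrite mulrC. Qed.

Lemma dotDl x x' y : dot (x + x') y = dot x y + dot x' y.
Proof. by rewrite /dot mulmxDl mxE. Qed.

Lemma dotNl x y : dot (- x) y = - dot x y.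
Proof. by rewrite /dot mulNmx mxE. Qed.

Lemma dotDr x y y' : dot x (y + y') = dot x y + dot x y'.
Proof. by rewrite !(dotC x) dotDl. Qed.

Lemma dotNr x y : dot x (- y) = - dot x y.
Proof. by rewrite !(dotC x) dotNl. Qed.

Lemma dot0l y : dot 0 y = 0.
Proof. by rewrite /dot mul0mx mxE. Qed.

Lemma dot0r x : dot x 0 = 0.
Proof. by rewrite dotC dot0l. Qed.

Lemma dot_mulmx x (M : 'M[F]_n) y : dot (x *m M) y = dot x (y *m M^T).
Proof. by rewrite /dot trmx_mul trmxK mulmxA. Qed.

Lemma dot_surj x a : x != 0 -> exists y, dot x y = a.
Proof.
case/rV0Pn=> i xi; exists ((a / x 0 i) *: delta_mx 0 i).
rewrite dotE (bigD1 i) //= !mxE !eqxx mulr1 mulrC divfK // big1 ?addr0 //.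
move=> j ji.
by rewrite !mxE (negPf ji) andbF !mulr0.
Qed.

Lemma symp_form_row x y x' y' :
  symp_form (row_mx x y) (row_mx x' y') = dot x y' - dot y x'.
Proof. by rewrite /symp_form !row_mxKl !row_mxKr mxE [X in _ + X]mxE. Qed.

End Dot.

Section Characters.

Variables (R : realType) (F : finFieldType) (p : nat) (pF : p \in [pchar F]).
Hypothesis p_odd : odd p.
Variable n : nat.

Local Notation psi := (psi R pF).
Implicit Types x y z : 'rV[F]_n.

Lemma psi_dot_neq1 x : x != 0 -> exists y, psi (2 * dot x y) != 1.
Proof.
move=> x0; have [a na] := psi_nontrivial R pF p_odd.
have [y Ey] := dot_surj (a / 2) x0; exists y.
by rewrite Ey mulrC divfK ?(two_neq0 pF).
Qed.

Lemma psi_dot_sum x :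
  \sum_y psi (- (2 * dot x y)) = if x == 0 then (#|F| ^ n)%:R else 0.
Proof.
case: eqVneq => [->|x0].
  under eq_bigr do rewrite dot0l mulr0 oppr0 psi0.
  by rewrite sumr_const card_mx mul1n.
have [y ny] := psi_dot_neq1 x0.
apply: (@psi_sum R F p pF 'rV[F]_n (fun z => - (2 * dot x z)) (- y)).
  by move=> u w; rewrite dotDr mulrDr opprD.
by rewrite dotNr mulrN opprK.
Qed.

(** [psi] turns the sum of squares into a product, so the sum splits into one Gauss sum per
    coordinate. *)
Lemma gauss_sum_row : \sum_(z : 'rV[F]_n) psi (- dot z z) = gauss_sum R pF ^+ n.
Proof.
rewrite /gauss_sum -[X in _ ^+ X](card_ord n) -prodr_const bigA_distr_bigA /=.
rewrite (reindex (fun f : {ffun 'I_n -> F} => \row_i f i)) /=; last first.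
  exists (fun z : 'rV[F]_n => [ffun i => z 0 i]) => [f _|z _].
    by apply/ffunP=> i; rewrite ffunE mxE.
  by apply/rowP=> i; rewrite mxE ffunE.
apply: eq_bigr => f _; rewrite dotE -sumrN.
rewrite (big_morph psi (psiD R pF) (psi0 R pF)).
by apply: eq_bigr => i _; rewrite !mxE expr2.
Qed.

End Characters.

(** * The Heisenberg operators and the vacuum projection *)

Section Heisenberg.

Variables (R : realType) (F : finFieldType) (p : nat) (pF : p \in [pchar F]).
Hypothesis p_odd : odd p.
Variable n : nat.

Local Notation psi := (psi R pF).
Local Notation N := (#|F| ^ n)%N.
Local Notation K := (R[i]).

Variable pi : 'rV[F]_(n + n) -> 'M[K]_N.
Hypothesis pi_unit : forall v, pi v \in unitmx.
Hypothesis piM : forall u v, pi u *m pi v = psi (symp_form u v) *: pi (u + v).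

Definition piA (x : 'rV[F]_n) := pi (row_mx x 0).
Definition piB (y : 'rV[F]_n) := pi (row_mx 0 y).

Lemma card_field_neq0 : (N%:R : K) != 0.
Proof. by rewrite pnatr_eq0 -lt0n expn_gt0 (cardD1 0). Qed.

Lemma pi0 : pi 0 = 1%:M.
Proof.
have := piM (row_mx 0 0) (row_mx 0 0); rewrite symp_form_row dot0l subrr.
rewrite psi0 scale1r row_mx0 addr0 => /(congr1 (mulmx (invmx (pi 0)))).
by rewrite mulmxA mulVmx ?mul1mx.
Qed.

Lemma piAD x x' : piA x *m piA x' = piA (x + x').
Proof.
by rewrite /piA piM symp_form_row dot0l dot0r subrr psi0 // scale1r add_row_mx
  addr0.
Qed.

Lemma piBD y y' : piB y *m piB y' = piB (y + y').
Proof.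
by rewrite /piB piM symp_form_row dot0l dot0r subrr psi0 // scale1r add_row_mx
  addr0.
Qed.

Lemma piA0 : piA 0 = 1%:M. Proof. by rewrite /piA row_mx0 pi0. Qed.
Lemma piB0 : piB 0 = 1%:M. Proof. by rewrite /piB row_mx0 pi0. Qed.

Lemma piBK y : piB y *m piB (- y) = 1%:M.
Proof. by rewrite piBD subrr piB0. Qed.

Lemma pi_row x y : pi (row_mx x y) = psi (- dot x y) *: (piA x *m piB y).
Proof.
rewrite piM symp_form_row dot0l subr0 scalerA mulrC psiK // scale1r.
by rewrite add_row_mx addr0 add0r.
Qed.

Lemma piAB x y : piA x *m piB y = psi (2 * dot x y) *: (piB y *m piA x).
Proof.
rewrite !piM !symp_form_row !dot0l subr0 sub0r scalerA -psiD // (dotC y) addrC.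
by congr (psi _ *: _); ring.
Qed.

(* The projection onto the line fixed by all pi (x, 0).  It is locked because
   unification with [_ *: _] would otherwise unfold it. *)
Definition vacuum : 'M[K]_N := locked (N%:R^-1 *: \sum_x piA x).
Local Notation P := vacuum.

Lemma vacuumE : P = N%:R^-1 *: \sum_x piA x.
Proof. by rewrite /vacuum -lock. Qed.

Lemma piA_vacuum x : piA x *m P = P.
Proof.
rewrite vacuumE -scalemxAr mulmx_sumr.
congr (_ *: _); rewrite [RHS](reindex_inj (addrI x)).
by apply: eq_bigr => y _; rewrite piAD.
Qed.

Lemma vacuum_piA x : P *m piA x = P.
Proof.
rewrite -{2}(piA_vacuum x) vacuumE -scalemxAl -scalemxAr mulmx_suml mulmx_sumr.
by congr (_ *: _); apply: eq_bigr => y _; rewrite !piAD addrC.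
Qed.

Lemma vacuum_idem : P *m P = P.
Proof.
rewrite {1}vacuumE -scalemxAl mulmx_suml.
under eq_bigr do rewrite piA_vacuum.
rewrite sumr_const card_mx mul1n -[P *+ _]scaler_nat scalerA.
by rewrite mulVf ?card_field_neq0 ?scale1r.
Qed.

(** Conjugation by a suitable [piB y] multiplies [piA x] by a scalar other than 1. *)
Lemma trace_piA x : x != 0 -> \tr (piA x) = 0.
Proof.
move=> x0; have [y ny] := psi_dot_neq1 R pF p_odd x0.
have : \tr (piA x) = psi (2 * dot x y) * \tr (piA x).
  rewrite -[in LHS](mulmx1 (piA x)) -(piBK y) mulmxA piAB -scalemxAl mxtraceZ.
  by rewrite mxtrace_mulC mulmxA piBD addNr piB0 mul1mx.
move/eqP; rewrite -{1}[\tr _]mul1r -subr_eq0 -mulrBl mulf_eq0 subr_eq0 eq_sym.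
by rewrite (negPf ny) => /eqP.
Qed.

Lemma trace_vacuum : \tr P = 1.
Proof.
rewrite vacuumE mxtraceZ raddf_sum (bigD1 0) //= big1 => [|x /trace_piA //].
by rewrite piA0 mxtrace1 addr0 mulVf ?card_field_neq0.
Qed.

Lemma vacuum_neq0 : P != 0.
Proof.
by apply: contra_eq_neq trace_vacuum => ->; rewrite mxtrace0 eq_sym oner_neq0.
Qed.

Lemma vacuum_sandwich X : P *m X *m P = \tr (X *m P) *: P.
Proof. exact: idem_trace1 vacuum_idem trace_vacuum. Qed.

(** [P] absorbs [piA x] on either side, but moving it across [piB y] costs a scalar that is not 1
    for a suitable [x]. *)
Lemma vacuum_piB_vacuum y : y != 0 -> P *m piB y *m P = 0.
Proof.
move=> y0; have [x nx] := psi_dot_neq1 R pF p_odd y0.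
have : P *m piB y *m P = psi (2 * dot y x) *: (P *m piB y *m P).
  rewrite -{1}(vacuum_piA x) -(mulmxA P) piAB -scalemxAr -scalemxAl dotC.
  by rewrite -!mulmxA piA_vacuum.
move/eqP; rewrite -{1}[X in X == _]scale1r -subr_eq0 -scalerBl scaler_eq0.
by rewrite subr_eq0 eq_sym (negPf nx) => /eqP.
Qed.

(** Conjugation by [piB y] scales [piA x] by [psi (- (2 * dot x y))]; summing over [y] leaves only
    [x = 0]. *)
Lemma vacuum_resolution : \sum_y piB y *m P *m piB (- y) = 1%:M.
Proof.
have E y x : piB y *m piA x *m piB (- y) = psi (- (2 * dot x y)) *: piA x.
  rewrite -mulmxA piAB dotNr mulrN -scalemxAr; congr (_ *: _).
  by rewrite mulmxA piBK mul1mx.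
transitivity (N%:R^-1 *: \sum_x \sum_y psi (- (2 * dot x y)) *: piA x).
  rewrite exchange_big scaler_sumr; apply: eq_bigr => y _ /=.
  rewrite vacuumE -scalemxAr -scalemxAl mulmx_sumr mulmx_suml; congr (_ *: _).
  by apply: eq_bigr => x _; rewrite E.
rewrite (bigD1 0) //= [X in _ + X]big1 => [|x x0].
  rewrite -scaler_suml psi_dot_sum // eqxx addr0 scalerA.
  by rewrite mulVf ?card_field_neq0 // scale1r piA0.
by rewrite -scaler_suml psi_dot_sum // (negPf x0) scale0r.
Qed.

(* The trace in the basis of the translates of the vacuum vector by piB. *)
Lemma trace_coherent X : \tr X = \sum_y \tr (piB (- y) *m X *m piB y *m P).
Proof.
rewrite -{1}[X]mulmx1 -vacuum_resolution mulmx_sumr raddf_sum /=.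
by apply: eq_bigr => y _; rewrite mulmxA mxtrace_mulC !mulmxA.
Qed.

End Heisenberg.

(** * Levi, Weyl and unipotent elements of the symplectic group *)

Section Symplectic.

Variables (F : finFieldType) (n : nat).
Local Notation GL2 := {'GL_(n.+1 + n.+1)[F]}.

Lemma Sp_of_mx (X Y : 'M[F]_(n.+1 + n.+1)) :
    X *m Y = 1%:M ->
    (forall u v, symp_form (u *m X) (v *m X) = symp_form u v) ->
  exists2 g : GL2, g \in Sp F n & GLmx g = X.
Proof.
move=> XY HX; have uX : X \in unitmx by case: (mulmx1_unit XY).
have uX' : (X : 'M[F]_((n.+1 + n.+1).-1.+1)) \is a GRing.unit by exact: uX.
by exists (FinRing.unit _ uX' : GL2) => //; apply/SpP => u v; exact: HX.
Qed.

Lemma Sp_levi (M M' : 'M[F]_n.+1) : M *m M' = 1%:M ->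
  exists2 h : GL2, h \in Sp F n & GLmx h = block_mx M 0 0 M'^T.
Proof.
move=> MM'; apply: (@Sp_of_mx _ (block_mx M' 0 0 M^T)).
  rewrite mulmx_block !(mulmx0, mul0mx, addr0, add0r) -trmx_mul.
  by rewrite MM' trmx1 -scalar_mx_block.
move=> u v; rewrite -(hsubmxK u) -(hsubmxK v) !mul_row_block.
rewrite !(mulmx0, addr0, add0r) !symp_form_row !dot_mulmx trmxK.
by rewrite -!mulmxA -trmx_mul !MM' trmx1 !mulmx1.
Qed.

Lemma Sp_weyl :
  exists2 w : GL2, w \in Sp F n & GLmx w = block_mx 0 1%:M (- 1%:M) 0.
Proof.
apply: (@Sp_of_mx _ (block_mx 0 (- 1%:M) 1%:M 0)).
  rewrite mulmx_block !(mulmx0, mul0mx, addr0, add0r, mulmx1, mulmxN, opprK).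
  by rewrite -scalar_mx_block.
move=> u v; rewrite -(hsubmxK u) -(hsubmxK v) !mul_row_block.
rewrite !(mulmx0, addr0, add0r, mulmxN, mulmx1) !symp_form_row dotNl dotNr.
by rewrite opprK addrC (dotC (lsubmx u)) dotC.
Qed.

Lemma gQ_Sp (Q : 'M[F]_n.+1) : Q \is symmetricmx -> gQ Q \in Sp F n.
Proof.
move=> sQ; apply: (subsetP (G_sub_Sp F n)).
by rewrite mem_gen // inE imset_f ?orbT.
Qed.

Lemma GLN1_Sp : GLN1 F n \in Sp F n.
Proof. by apply: (subsetP (G_sub_Sp F n)); rewrite mem_gen // inE cycle_id. Qed.

End Symplectic.

(** * The Weil operators on the vacuum and its translates *)

Section Weil.

Variables (R : realType) (F : finFieldType) (p : nat) (pF : p \in [pchar F]).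
Hypothesis p_odd : odd p.
Variable n : nat.

Local Notation psi := (psi R pF).
Local Notation N := (#|F| ^ n.+1)%N.
Local Notation K := (R[i]).
Local Notation GL2 := {'GL_(n.+1 + n.+1)[F]}.

Variable pi : 'rV[F]_(n.+1 + n.+1) -> 'M[K]_N.
Hypothesis pi_unit : forall v, pi v \in unitmx.
Hypothesis piM : forall u v, pi u *m pi v = psi (symp_form u v) *: pi (u + v).

Variable W : GL2 -> 'M[K]_N.
Hypothesis WM : {in Sp F n &, forall g h, W (g * h)%g = W g *m W h}.
Hypothesis W1 : W 1%g = 1%:M.
Hypothesis piW : forall g, g \in Sp F n ->
  forall v, pi v *m W g = W g *m pi (v *m GLmx g).
Hypothesis W_unip_vacuum : n.+1 = 1%N -> #|F| = 3%N ->
  forall Q : 'M[F]_n.+1, Q \is symmetricmx ->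
  W (gQ Q) *m vacuum pi = vacuum pi.

Local Notation A := (piA pi).
Local Notation B := (piB pi).
Local Notation P := (vacuum pi).

Let AP := piA_vacuum piM.
Let PA := vacuum_piA piM.
Let PP := vacuum_idem piM.
Let trP := trace_vacuum p_odd pi_unit piM.
Let P0 := vacuum_neq0 p_odd pi_unit piM.
Let PXP := vacuum_sandwich p_odd pi_unit piM.
Let AB := piAB piM.

Lemma W_unit g : g \in Sp F n -> W g \in unitmx.
Proof.
move=> Sg; have : W g *m W g^-1%g = 1%:M by rewrite -WM ?groupV // mulgV.
by case/mulmx1_unit.
Qed.

Lemma scale_vacuum_inj (a b : K) : a *: P = b *: P -> a = b.
Proof.
move/eqP; rewrite -subr_eq0 -scalerBl scaler_eq0 (negPf P0) orbF subr_eq0.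
by move/eqP.
Qed.

(** Moving [W g] across the operators [pi (x, 0)] only permutes them, and [P] is their average. *)
Lemma W_vacuum_comm g (M : 'M[F]_n.+1) : g \in Sp F n -> M \in unitmx ->
    (forall x : 'rV[F]_n.+1, row_mx x 0 *m GLmx g = row_mx (x *m M) 0) ->
  P *m W g = W g *m P.
Proof.
move=> Sg uM gM; rewrite vacuumE -scalemxAl -scalemxAr mulmx_suml mulmx_sumr.
congr (_ *: _); rewrite [RHS](reindex_inj (can_inj (mulmxK uM))) /=.
by apply: eq_bigr => x _; rewrite /piA piW // gM.
Qed.

Lemma comm_vacuum X : P *m X = X *m P -> X *m P = \tr (X *m P) *: P.
Proof. by move=> PX; rewrite -PXP PX -mulmxA PP. Qed.

Lemma row_gQ (Q : 'M[F]_n.+1) (x y : 'rV_n.+1) :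
  row_mx x y *m GLmx (gQ Q) = row_mx (x + y *m Q) y.
Proof. by rewrite GLmx_gQ mul_row_block !mulmx1 mulmx0 add0r. Qed.

Lemma vacuum_gQ Q : Q \is symmetricmx -> P *m W (gQ Q) = W (gQ Q) *m P.
Proof.
move=> sQ; apply: (@W_vacuum_comm _ 1%:M); rewrite ?gQ_Sp ?unitmx1 // => x.
by rewrite row_gQ mul0mx mulmx1 addr0.
Qed.

(* The scalar by which g_Q acts on the vacuum line. *)
Definition unip_eig Q : K := \tr (W (gQ Q) *m P).

Lemma unip_eigP Q : Q \is symmetricmx -> W (gQ Q) *m P = unip_eig Q *: P.
Proof. by move/vacuum_gQ/comm_vacuum. Qed.

Lemma symmetricmxD (Q Q' : 'M[F]_n.+1) :
  Q \is symmetricmx -> Q' \is symmetricmx -> Q + Q' \is symmetricmx.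
Proof. by rewrite !symmetricmxE linearD /= => /eqP-> /eqP->. Qed.

Lemma unip_eigD Q Q' : Q \is symmetricmx -> Q' \is symmetricmx ->
  unip_eig (Q + Q') = unip_eig Q * unip_eig Q'.
Proof.
move=> sQ sQ'; apply: scale_vacuum_inj; rewrite -unip_eigP ?symmetricmxD //.
rewrite -gQM WM ?gQ_Sp // -mulmxA unip_eigP // -scalemxAr unip_eigP // scalerA.
by rewrite mulrC.
Qed.

Lemma unip_eig0 : unip_eig 0 = 1.
Proof. by rewrite /unip_eig gQ0 W1 mul1mx. Qed.

(** The Levi element of [M] conjugates one unipotent element into the other and acts invertibly on
    the vacuum line. *)
Lemma unip_eig_congr (M M' Q : 'M[F]_n.+1) :
  M *m M' = 1%:M -> Q \is symmetricmx ->
  unip_eig (M^T *m Q *m M) = unip_eig Q.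
Proof.
move=> MM' sQ; have [h Sh hE] := Sp_levi MM'.
have [uM _] := mulmx1_unit MM'.
have sQ' : M^T *m Q *m M \is symmetricmx.
  by move: sQ; rewrite !symmetricmxE !trmx_mul trmxK mulmxA => /eqP->.
have E : (h * gQ (M^T *m Q *m M) = gQ Q * h)%g.
  apply: GLmx_inj; rewrite !GLmxM !GLmx_gQ hE !mulmx_block.
  rewrite !(mulmx0, mul0mx, addr0, add0r, mulmx1, mul1mx).
  by rewrite !mulmxA -trmx_mul MM' trmx1 mul1mx.
have Ph : P *m W h = W h *m P.
  apply: (W_vacuum_comm Sh uM) => x.
  by rewrite hE mul_row_block !mulmx0 mul0mx !addr0.
have : W h *m (W (gQ (M^T *m Q *m M)) *m P) = W (gQ Q) *m (W h *m P).
  by rewrite !mulmxA -!WM ?gQ_Sp // E.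
rewrite (unip_eigP sQ') -Ph [W (gQ Q) *m _]mulmxA (unip_eigP sQ) -scalemxAl Ph.
rewrite !scalemxAr => /(can_inj (mulKmx (W_unit Sh))).
exact: scale_vacuum_inj.
Qed.

(** Reduces triviality of [unip_eig] at a symmetric matrix to writing that matrix as
    [M^T *m Q *m M - Q]. *)
Lemma unip_eig_coinv (M M' Q : 'M[F]_n.+1) :
  M *m M' = 1%:M -> Q \is symmetricmx ->
  unip_eig (M^T *m Q *m M - Q) = 1.
Proof.
move=> MM' sQ; have sNQ : - Q \is symmetricmx.
  by move: sQ; rewrite !symmetricmxE linearN /= => /eqP->.
have sQ' : M^T *m Q *m M \is symmetricmx.
  by move: sQ; rewrite !symmetricmxE !trmx_mul trmxK mulmxA => /eqP->.
by rewrite unip_eigD // (unip_eig_congr MM') // -unip_eigD // subrr unip_eig0.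
Qed.

Lemma symmetric_delta (i j : 'I_n.+1) (a : F) :
  a *: (delta_mx i j + delta_mx j i) \is symmetricmx.
Proof. by rewrite symmetricmxE linearZ linearD /= !trmx_delta addrC. Qed.

(* Conjugation by diag(1, .., -1, .., 1) negates the off-diagonal units. *)
Lemma unip_eig_offdiag (i j : 'I_n.+1) a : i != j ->
  unip_eig (a *: (delta_mx i j + delta_mx j i)) = 1.
Proof.
move=> ij; have h2 : (2 : F) != 0 := two_neq0 pF p_odd.
pose d : 'rV[F]_n.+1 := \row_k (-1) ^+ (k == i).
have dd : diag_mx d *m diag_mx d = 1%:M.
  rewrite mulmx_diag -diag_const_mx; congr diag_mx; apply/rowP => k.
  by rewrite !mxE -expr2 sqrr_sign.
(* Conjugation negates this multiple of the off-diagonal unit, so the difference is [-2] times it;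
   hence the factor [- (a / 2)]. *)
rewrite -[RHS](unip_eig_coinv dd (symmetric_delta i j (- (a / 2)))).
congr unip_eig.
apply/matrixP=> k l; rewrite tr_diag_mx mul_mx_diag mul_diag_mx !mxE.
by have [->|ki] := eqVneq k i; have [->|li] := eqVneq l i;
  rewrite ?(negPf ij) ?andbF /= ?expr0 ?expr1; field.
Qed.

Lemma unip_eig_eq1_elem (i j : 'I_n.+1) a :
  unip_eig (a *: (delta_mx i j + delta_mx j i)) = 1.
Proof.
have [<-{j}|] := eqVneq i j; last exact: unip_eig_offdiag.
(* Transvections settle n > 1, scalars b with b ^ 2 <> 1 settle q > 3, and the
   remaining case (n, q) = (1, 3) is the normalization of W. *)
have [k ki|noK] := pickP (fun k : 'I_n.+1 => k != i).
  pose M : 'M[F]_n.+1 := 1%:M + delta_mx k i.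
  have MM' : M *m (1%:M - delta_mx k i) = 1%:M.
    rewrite mulmxBr mulmx1 mulmxDl mul1mx mul_delta_mx_cond eq_sym (negPf ki).
    by rewrite mulr0n addr0 addrK.
  have := unip_eig_coinv MM' (symmetric_delta k k a).
  (* The transvection adds the wanted diagonal matrix at [i] and an off-diagonal one, whose
     eigenvalue is already known to be 1. *)
  have -> : M^T *m (a *: (delta_mx k k + delta_mx k k)) *m M
      - a *: (delta_mx k k + delta_mx k k) =
    a *: (delta_mx i i + delta_mx i i) +
    (2 * a) *: (delta_mx k i + delta_mx i k).
    have -> : M^T = 1%:M + delta_mx i k by rewrite linearD /= trmx1 trmx_delta.
    rewrite /M -scalemxAr -scalemxAl.
    rewrite !(mulmxDl, mulmxDr, mulmx1, mul1mx) !mul_delta_mx.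
    by apply/matrixP=> u v; rewrite !mxE; ring.
  by rewrite unip_eigD ?symmetric_delta // (unip_eig_offdiag _ ki) mulr1.
have n1 : n.+1 = 1%N.
  rewrite -[LHS]card_ord -(card1 i); apply: eq_card => k.
  by have := noK k; rewrite !inE => /negbFE.
have [/existsP[b /andP[b0 b1]]|] :=
  boolP [exists b : F, (b != 0) && (b ^+ 2 != 1)].
  have bb : (b%:M : 'M[F]_n.+1) *m b^-1%:M = 1%:M.
    by rewrite -scalar_mxM mulfV.
  (* Congruence by the scalar [b] multiplies by [b ^+ 2]; dividing by [b ^+ 2 - 1] compensates for
     the difference. *)
  rewrite -[RHS](unip_eig_coinv bb (symmetric_delta i i (a / (b ^+ 2 - 1)))).
  congr unip_eig.
  rewrite tr_scalar_mx mul_scalar_mx mul_mx_scalar !scalerA -scalerBl.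
  by congr (_ *: _); field; rewrite subr_eq0.
move=> /existsPn noB; have cF : #|F| = 3%N.
  transitivity #|[set 0; 1; -1 : F]|.
    rewrite -cardsT; apply: eq_card => b; have := noB b; rewrite !inE.
    by rewrite negb_and !negbK sqrf_eq1 orbA => ->.
  rewrite -setUA cardsU1 cards2 !inE eq_sym oner_eq0 eq_sym oppr_eq0 oner_eq0.
  by rewrite -addr_eq0 -mulr2n (negPf (two_neq0 pF p_odd)).
have sT := symmetric_delta i i a.
by apply: scale_vacuum_inj; rewrite -unip_eigP // scale1r; exact: W_unip_vacuum.
Qed.

(** In odd characteristic [Q] is half of [Q + Q^T], a sum of the elementary symmetric matrices, and
    [unip_eig] is multiplicative. *)
Lemma unip_eig_eq1 Q : Q \is symmetricmx -> unip_eig Q = 1.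
Proof.
move=> sQ; have h2 : (2 : F) != 0 := two_neq0 pF p_odd.
have -> : Q = \sum_i \sum_j (Q i j / 2) *: (delta_mx i j + delta_mx j i).
  have {1}-> : Q = 2^-1 *: (Q + Q^T).
    move: sQ; rewrite symmetricmxE => /eqP->.
    by rewrite -mulr2n -scaler_nat scalerA mulVf // scale1r.
  have -> : Q^T = \sum_i \sum_j Q i j *: delta_mx j i.
    rewrite {1}(matrix_sum_delta Q) raddf_sum; apply: eq_bigr => i _ /=.
    rewrite raddf_sum; apply: eq_bigr => j _ /=.
    by rewrite linearZ /= trmx_delta.
  rewrite {1}(matrix_sum_delta Q) -big_split scaler_sumr /=.
  apply: eq_bigr => i _; rewrite -big_split scaler_sumr /=.
  by apply: eq_bigr => j _; rewrite -scalerDr scalerA mulrC.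
pose good (T : 'M[F]_n.+1) := T \is symmetricmx /\ unip_eig T = 1.
have goodD T T' : good T -> good T' -> good (T + T').
  move=> [sT cT] [sT' cT']; split; first exact: symmetricmxD.
  by rewrite unip_eigD // cT cT' mulr1.
have good0 : good 0 by split; rewrite ?unip_eig0 // symmetricmxE trmx0.
suff: good (\sum_i \sum_j (Q i j / 2) *: (delta_mx i j + delta_mx j i)) by case.
apply: (big_ind good) => // i _; apply: (big_ind good) => // j _.
split; last exact: unip_eig_eq1_elem.
by rewrite symmetricmxE linearZ linearD /= !trmx_delta addrC.
Qed.

Lemma gQ_vacuum Q : Q \is symmetricmx -> W (gQ Q) *m P = P.
Proof. by move=> sQ; rewrite unip_eigP // unip_eig_eq1 // scale1r. Qed.

Lemma gQ_coherent Q y : Q \is symmetricmx ->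
  W (gQ Q) *m B y *m P = psi (- dot (y *m Q) y) *: (B y *m P).
Proof.
move=> sQ; set d := dot _ _.
have : B y *m P = psi d *: (W (gQ Q) *m B y *m P).
  rewrite -{1}(gQ_vacuum sQ) mulmxA [B y *m _]piW ?gQ_Sp // row_gQ add0r.
  (* Splitting [pi (y Q, y)] gives [psi (- d)], commuting its two factors gives [psi (2 * d)], and
     the vacuum absorbs the remaining [A (y *m Q)]. *)
  rewrite (pi_row piM) -/d -!scalemxAr AB -!scalemxAr scalerA -psiD.
  rewrite -!scalemxAl -!mulmxA AP; congr (psi _ *: _).
  by rewrite -/d; ring.
by move=> ->; rewrite scalerA mulrC psiK scale1r.
Qed.

Lemma trace_gQ Q : Q \is symmetricmx ->
  \tr (W (gQ Q)) = \sum_(y : 'rV[F]_n.+1) psi (- dot (y *m Q) y).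
Proof.
move=> sQ; rewrite (trace_coherent p_odd pi_unit piM); apply: eq_bigr => y _.
rewrite -!mulmxA [W _ *m _]mulmxA gQ_coherent // -scalemxAr mxtraceZ mulmxA.
by rewrite (piBD piM) addNr (piB0 pi_unit piM) mul1mx trP mulr1.
Qed.

(** The scalar by which [-I] acts on the vacuum line. *)
Definition kappa : K := \tr (W (GLN1 F n) *m P).

Lemma pi_GLN1 v : pi v *m W (GLN1 F n) = W (GLN1 F n) *m pi (- v).
Proof. by rewrite piW ?GLN1_Sp // GLmxN1 mulmxN mulmx1. Qed.

Lemma vacuum_GLN1 : P *m W (GLN1 F n) = W (GLN1 F n) *m P.
Proof.
apply: (@W_vacuum_comm _ (- 1%:M)); rewrite ?GLN1_Sp //.
  by have [] := @mulmx1_unit _ _ (- 1%:M : 'M[F]_n.+1) (- 1%:M)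
    (etrans (mulmxN _ _) (etrans (congr1 _ (mulmx1 _)) (opprK _))).
by move=> x; rewrite GLmxN1 mulmxN mulmx1 opp_row_mx oppr0 mulmxN mulmx1.
Qed.

(** The translate of the vacuum by [y] goes to a multiple of the one by [- y], so it contributes to
    the trace only if [y + y = 0], that is, [y = 0]. *)
Lemma trace_GLN1_gQ Q : Q \is symmetricmx ->
  \tr (W (GLN1 F n * gQ Q)%g) = kappa.
Proof.
move=> sQ; rewrite WM ?GLN1_Sp ?gQ_Sp // (trace_coherent p_odd pi_unit piM).
have term y : \tr (B (- y) *m (W (GLN1 F n) *m W (gQ Q)) *m B y *m P) =
    psi (- dot (y *m Q) y) * \tr (W (GLN1 F n) *m (B (y + y) *m P)).
  rewrite -!mulmxA [W (gQ Q) *m _]mulmxA gQ_coherent // -!scalemxAr mxtraceZ.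
  rewrite mulmxA /piB pi_GLN1 opp_row_mx oppr0 opprK -mulmxA.
  congr (_ * \tr (_ *m _)).
  by rewrite mulmxA -/(B y) (piBD piM).
rewrite (bigD1 0) //= big1 => [|y y0]; rewrite term.
  by rewrite !addr0 (piB0 pi_unit piM) mul1mx mul0mx dot0l oppr0 psi0 mul1r.
have yy : y + y != 0.
  by rewrite addr_eq0 row_neq_opp ?(two_neq0 pF).
rewrite -PP !mulmxA mxtrace_mulC !mulmxA vacuum_GLN1 -!mulmxA.
rewrite [P *m (_ *m _)]mulmxA (vacuum_piB_vacuum p_odd piM yy).
by rewrite mulmx0 mxtrace0 mulr0.
Qed.

Lemma kappaE : kappa = (delta F)%:~R ^+ n.+1.
Proof.
have [w Sw wE] := Sp_weyl F n; pose l : GL2 := gQ 1%:M.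
have s1 : (1%:M : 'M[F]_n.+1) \is symmetricmx by rewrite symmetricmxE trmx1.
have Sl : l \in Sp F n by exact: gQ_Sp.
have row_w (x y : 'rV_n.+1) : row_mx x y *m GLmx w = row_mx (- y) x.
  by rewrite wE mul_row_block !mulmx0 mulmxN !mulmx1 add0r addr0.
have ww : (w * w = GLN1 F n)%g.
  apply: GLmx_inj; rewrite GLmxM GLmxN1 wE mulmx_block.
  rewrite !(mulmx0, mul0mx, addr0, add0r, mulmx1, mul1mx).
  by rewrite (scalar_mx_block (n.+1) (n.+1)) opp_block_mx oppr0.
(* This is [(w l)^3 = -I] rearranged by [w^2 = -I], so that [P] absorbs both outer factors [l]. *)
have lwlwl : (l * (w * (l * (w * l))) = w)%g.
  apply: GLmx_inj; rewrite !GLmxM GLmx_gQ wE !mulmx_block.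
  rewrite !(mulmx0, mul0mx, addr0, add0r, mulmx1, mul1mx, mulNmx, mulmxN).
  by rewrite !(addNr, addr0, add0r, subrr, oppr0).
have [Pl lP] := (vacuum_gQ s1, gQ_vacuum s1).
have lB z : W l *m B z *m P = psi (- dot z z) *: (B z *m P).
  by rewrite gQ_coherent // mulmx1.
rewrite -/l in Pl lP; clearbody l.
(* W w is gam times a finite Fourier transform, so that w ^ 2 = -1 gives
   kappa = gam ^ 2 q ^ n, and l w l w l = w relates gam to the Gauss sum. *)
pose gam := \tr (W w *m P).
have PwP : P *m W w *m P = gam *: P by rewrite PXP.
have Aw x : A x *m W w = W w *m B x by rewrite /piA piW // row_w oppr0.
have Bw y : B y *m W w = W w *m A (- y) by rewrite /piB piW // row_w.
(* In the inserted resolution of the identity, [B (- z)] crosses [W w] as [A z] and is absorbed by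
   [P]. *)
have wP : W w *m P = gam *: \sum_z B z *m P.
  rewrite -{1}[W w]mul1mx -(vacuum_resolution p_odd pi_unit piM) !mulmx_suml.
  rewrite scaler_sumr; apply: eq_bigr => z _.
  rewrite -!mulmxA [B (- z) *m _]mulmxA Bw opprK -[_ *m A z *m P]mulmxA AP.
  by rewrite [P *m _]mulmxA PwP scalemxAr.
have PwB z : P *m (W w *m (B z *m P)) = gam *: P.
  by rewrite [W w *m _]mulmxA -Aw !mulmxA PA PwP.
have kE : kappa = gam ^+ 2 * N%:R.
  apply: scale_vacuum_inj; rewrite -comm_vacuum ?vacuum_GLN1 //.
  rewrite -{1}PP mulmxA -vacuum_GLN1 -ww WM // -!mulmxA wP.
  rewrite -!scalemxAr !mulmx_sumr.
  under eq_bigr do rewrite PwB.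
  by rewrite sumr_const card_mx mul1n -[_ *+ _]scaler_nat !scalerA expr2 mulrAC.
have gE : gam = gam ^+ 2 * gauss_sum R pF ^+ n.+1.
  have Wlw : W w = W l *m (W w *m (W l *m (W w *m W l))).
    by rewrite -!WM ?groupM // lwlwl.
  have E : P *m W w *m P = P *m (W w *m (W l *m (W w *m P))).
    by rewrite {1}Wlw mulmxA Pl lP -!mulmxA lP.
  apply: scale_vacuum_inj; rewrite -PwP E wP -!scalemxAr !mulmx_sumr.
  under eq_bigr => z _.
    rewrite [W l *m _]mulmxA lB -!scalemxAr PwB; over.
  rewrite -gauss_sum_row -scaler_suml !scalerA; congr (_ *: _).
  by rewrite expr2 mulrAC.
have gam0 : gam != 0.
  apply: contraNneq P0 => g0; move: wP; rewrite g0 scale0r => wP.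
  by rewrite -(mulKmx (W_unit Sw) P) wP mulmx0.
have g1 : gam * gauss_sum R pF ^+ n.+1 = 1.
  by apply: (mulfI gam0); rewrite mulrA -expr2 -gE mulr1.
have dd : (delta F)%:~R ^+ n.+1 * (delta F)%:~R ^+ n.+1 = 1 :> K.
  by rewrite -exprMn -intrM delta_sqr expr1n.
(* Since [gauss_sum ^+ 2] is [delta] times [q], the left side is the square of
   [gam * gauss_sum R pF ^+ n.+1]. *)
have : kappa * (delta F)%:~R ^+ n.+1 = 1.
  rewrite kE natrX -mulrA [X in _ * X]mulrC -exprMn -(gauss_sum_sqr _ pF p_odd).
  by rewrite exprAC -exprMn g1 expr1n.
move/(congr1 (fun c => c * (delta F)%:~R ^+ n.+1)).
by rewrite -mulrA dd mulr1 mul1r.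
Qed.

End Weil.

(** * Comparison of both sides on [B] and on its coset by [-I] *)

Lemma mem_G (F : finFieldType) (p n : nat) (pF : p \in [pchar F]) g :
  odd p -> g \in G F n -> exists2 Q : 'M[F]_n.+1,
    Q \is symmetricmx & g = gQ Q \/ g = (GLN1 F n * gQ Q)%g.
Proof.
move=> p_odd; rewrite -(dprodW (G_dprod n pF p_odd)).
case/mulsgP=> x _ + /imsetP[Q sQ ->] ->.
case/cycleP=> i ->; exists Q => //.
rewrite -(odd_double_half i) expgD -mul2n expgM !expgS expg0 mulg1 GLN1_sqr.
rewrite expg1n mulg1; case: (odd i); first by right; rewrite expg1.
by left; rewrite expg0 mul1g.
Qed.

Theorem theorem5 (R : realType) (F : finFieldType) (p : nat)
    (pF : p \in [pchar F]) (p_odd : odd p) (n : nat)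
    (omega : {'GL_(n.+1 + n.+1)[F]} -> R[i]) :
  weil_character pF omega ->
  (forall g, g \in G F n ->
     omega g =
       (1 + (delta F)%:~R ^+ n.+1) / 2 * lambdaG R pF false 0 g
     + (1 - (delta F)%:~R ^+ n.+1) / 2 * lambdaG R pF true 0 g
     + \sum_(S : 'M[F]_n.+1 |
              [&& S \is symmetricmx, \rank S == 1%N & Delta S == delta F])
         (lambdaG R pF false S g + lambdaG R pF true S g)) /\
  (forall g, g \in B F n ->
     omega g =
       lambda R pF 0 g
     + 2 * \sum_(S : 'M[F]_n.+1 |
              [&& S \is symmetricmx, \rank S == 1%N & Delta S == delta F])
             lambda R pF S g).
Proof.
case=> W0 [pi [[pi_unit piM _] piW0 W3]] omegaE0.
(* Forgetting the representation structure keeps unification fast. *)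
have [W [WM W1 WE]] :
    exists W : {'GL_(n.+1 + n.+1)[F]} -> 'M[R[i]]_(#|F| ^ n.+1), [/\
      {in Sp F n &, forall g h, W (g * h)%g = W g *m W h}, W 1%g = 1%:M
      & forall g, W0 g = W g].
  by exists W0; split=> //; [exact: repr_mxM | exact: repr_mx1].
have omegaE g : g \in Sp F n -> omega g = \tr (W g).
  by move=> Sg; rewrite omegaE0 // WE.
have piW g : g \in Sp F n -> forall v, pi v *m W g = W g *m pi (v *m GLmx g).
  move=> Sg v; rewrite -piW0 // -WE -[X in _ = _ *m X]mulmxA.
  by rewrite mulKVmx // repr_mx_unit.
have W_vac : n.+1 = 1%N -> #|F| = 3%N -> forall Q : 'M[F]_n.+1,
    Q \is symmetricmx -> W (gQ Q) *m vacuum pi = vacuum pi.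
  (* The normalization concerns vectors fixed by all [pi (x, 0)]; every column of [vacuum pi] is
     one. *)
  move=> n1 F3 Q sQ; apply: trmx_inj; apply/row_matrixP => j.
  rewrite -!tr_col !colE -mulmxA -WE W3 // => x.
  by rewrite mulmxA (piA_vacuum piM).
clear omegaE0 piW0 W3 WE W0.
have trE (Q : 'M[F]_n.+1) : Q \is symmetricmx -> omega (gQ Q) =
    lambda R pF 0 (gQ Q) + 2 * \sum_(S : 'M[F]_n.+1 |
      [&& S \is symmetricmx, \rank S == 1%N & Delta S == delta F])
        lambda R pF S (gQ Q).
  move=> sQ; rewrite omegaE ?gQ_Sp //.
  rewrite (trace_gQ p_odd pi_unit piM WM W1 piW W_vac sQ).
  rewrite -(sum_rank1 (two_neq0 pF p_odd) (fun S => lambda R pF S (gQ Q))).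
  apply: eq_bigr => z _; rewrite lambda_gQ mulNmx raddfN /= -mulmxA.
  by rewrite mxtrace_mulC [X in \tr X]mx11_scalar mxtrace_scalar.
split=> g; last by case/imsetP=> Q sQ ->; exact: trE.
case/(mem_G pF p_odd) => Q sQ [] ->.
  (* On [B] the two signs agree: the coefficients at 0 add up to 1 and each rank-one [S] counts
     twice. *)
  rewrite trE // !lambdaG_gQ // lambda_gQ -mulrDl; congr (_ + _).
    by rewrite -mulrDl addrACA subrr addr0 -mulr2n divff ?mul1r // pnatr_eq0.
  rewrite mulr_sumr; apply: eq_bigr => S _.
  by rewrite !lambdaG_gQ // lambda_gQ mulr_natl mulr2n.
have SQ : (GLN1 F n * gQ Q)%g \in Sp F n by rewrite groupM ?GLN1_Sp ?gQ_Sp.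
rewrite omegaE //.
rewrite (trace_GLN1_gQ p_odd pi_unit piM WM W1 piW W_vac sQ).
rewrite (kappaE p_odd pi_unit piM WM W1 piW W_vac).
(* On the other coset each rank-one pair cancels, and the difference of the coefficients at 0 is the
   power of [delta]. *)
rewrite !lambdaG_NgQ // mul0mx mxtrace0 psi0 !mulr1 /= big1 => [|S _].
  by field.
by rewrite !lambdaG_NgQ //= mul1r mulN1r subrr.
Qed.
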